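(* Let $\psi,\nu\in\Psi$, let $F,G\subset\mathcal B$ be sub-sigma-algebras with $\beta(F,G)>0$, and let $\xi\in G\psi$ be an $F$-measurable random variable and $\eta\in G\nu$ a $G$-measurable random variable. Put $$\zeta(p)=\zeta[\psi,\nu](p):=\psi(p)\,\nu\!\left(\frac{p}{p-1}\right).$$ Then $$|\mathrm{Cov}(\xi,\eta)|\le \frac{2\,\|\xi\|_{G\psi}\,\|\eta\|_{G\nu}}{\phi[G\zeta[\psi,\nu]]\bigl(1/\beta(F,G)\bigr)} .$$
   Context: $(\Omega,\mathcal B,\mathbf P)$ is a probability space with expectation $\mathbf E$; $\mathrm{Cov}(\xi,\eta):=\mathbf E\,\xi\eta-\mathbf E\xi\,\mathbf E\eta$; $|\xi|_p=(\mathbf E|\xi|^p)^{1/p}$ for $1\le p<\infty$. Random variables are numerical (real or complex) valued. Strong (Ibragimov) mixing coefficient: $\beta(F,G):=\sup\{|\mathbf P(B\mid A)-\mathbf P(B)| : A\in F,\ B\in G,\ \mathbf P(A)>0\}$. For $b\in(1,\infty]$, $\Psi(b)$ is the set of functions $\psi$ that are finite and continuous on $[1,b)$ (or on $[1,b]$ when $b<\infty$), with $\inf\psi>0$, and extended by $\psi(p):=\infty$ for all other $p$, so that $b=\sup\{p:\psi(p)<\infty\}$. Here $\psi\in\Psi$ means $\psi\in\Psi(b)$ for some $b\in(1,\infty]$ (the values of $b$ for $\psi$ and $\nu$ may differ). The Grand Lebesgue Space $G\psi$ consists of all random variables $\xi$ with finite norm $\|\xi\|_{G\psi}:=\sup\{|\xi|_p/\psi(p):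 p\ge 1,\ \psi(p)<\infty\}$. The fundamental function is $\phi[G\zeta](\delta):=\sup_p \delta^{1/p}/\zeta(p)$ for $\delta\in(0,\infty)$, where for the function $\zeta=\zeta[\psi,\nu]$ the supremum is over all $p\in(1,\infty)$ with $\zeta(p)<\infty$. If there is no such $p$, the supremum is $0$ and the right-hand side of the inequality is read as $+\infty$ (no assertion is made). *)

(* Defs.v *)
From HB Require Import structures.
From mathcomp Require Import all_boot all_order all_algebra.
From mathcomp Require Import all_classical all_reals all_analysis.
From mathcomp.real_closed Require Import complex.

Set Implicit Arguments.
Unset Strict Implicit.
Unset Printing Implicit Defensive.

Import Order.TTheory GRing.Theory Num.Theory.
Import numFieldTopology.Exports numFieldNormedType.Exports.

Local Open Scope classical_set_scope.
Local Open Scope ring_scope.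
Local Open Scope ereal_scope.

Section mixing.
Context d (T : measurableType d) (R : realType) (P : probability T R).
Implicit Types (F G : set_system T) (xi eta : T -> R[i]).

Definition is_sub_sigma_algebra F := sigma_algebra setT F /\ F `<=` measurable.

(* Complex random variables are handled through their real and imaginary
   parts; a real random variable X is the special case of [fun w => (X w)%:C],
   for which all the notions below reduce to the real ones. *)
Definition measurable_wrt F xi :=
  preimage_set_system setT (fun w => complex.Re (xi w)) measurable `<=` F /\
  preimage_set_system setT (fun w => complex.Im (xi w)) measurable `<=` F.

Definition cexpectation xi : R[i] :=
  Complex (fine (expectation P (fun w => complex.Re (xi w))))
          (fine (expectation P (fun w => complex.Im (xi w)))).

(* There is no conjugation of eta. *)
Definition Cov xi eta : R[i] :=
  (cexpectation (fun w => xi w * eta w)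
   - cexpectation xi * cexpectation eta)%R.

Definition Lp_norm (p : R) xi : \bar R :=
  Lnorm P p%:E (fun w => (Normc.normc (xi w))%:E).

Definition cond_prob (B A : set T) : R :=
  (fine (P (B `&` A)) / fine (P A))%R.

(* The set is nonempty and bounded by 1, so [sup] is its least upper bound. *)
Definition mixing_coef F G : R :=
  sup [set r | exists A B, [/\ F A, G B, 0 < P A &
    r = `|cond_prob B A - fine (P B)|%R]].

Definition GLS_norm (psi : R -> \bar R) xi : \bar R :=
  ereal_sup [set Lp_norm p xi / psi p |
    p in [set p : R | (1 <= p)%R /\ psi p < +oo]].

Definition GLS (psi : R -> \bar R) xi :=
  measurable_wrt measurable xi /\ GLS_norm psi xi < +oo.

End mixing.

Section generating_functions.
Context (R : realType).
Implicit Types (psi nu zeta : R -> \bar R).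

Definition Psi_dom (b : \bar R) (I : set R) :=
  I = [set p | (1 <= p)%R /\ p%:E < b] \/
  (b < +oo /\ I = [set p | (1 <= p)%R /\ p%:E <= b]).

Definition Psi_b (b : \bar R) psi :=
  1 < b /\ exists I : set R, [/\ Psi_dom b I,
    forall p, I p -> psi p \is a fin_num,
    {within I, continuous psi},
    0 < ereal_inf [set psi p | p in I] &
    forall p, ~ I p -> psi p = +oo].

Definition Psi psi := exists b, Psi_b b psi.

Definition zeta_fun psi nu (p : R) : \bar R := psi p * nu (p / (p - 1))%R.

(* The maximum with 0 only matters when no p is admissible: the supremum of the
   empty set is then 0 rather than -oo. *)
Definition fundamental_function zeta (delta : R) : \bar R :=
  maxe 0 (ereal_sup [set (delta `^ p^-1)%:E / zeta p |
    p in [set p : R | (1 < p)%R /\ zeta p < +oo]]).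

(* Division by the value of a fundamental function; the case of a zero
   denominator is separated because 0 / 0 = 0 in \bar R. *)
Definition div_or_pinfty (x y : \bar R) : \bar R :=
  if y == 0 then +oo else x / y.

End generating_functions.

(* Main.v *)
Require Import Defs.
From mathcomp Require Import all_boot all_order all_algebra.
From mathcomp Require Import finmap.
From mathcomp Require Import all_classical all_reals all_analysis.
From mathcomp Require Import measurable_realfun ring lra.
From mathcomp.real_closed Require Import complex.

(** For every conjugate pair of finite exponents p, q > 1 one has the
    Ibragimov inequality
      |Cov(xi, eta)| <= 2 beta^(1/p) |xi|_p |eta|_q          ([Cov_Lp_le]).
    Bounding |xi|_p by psi(p) ||xi|| and |eta|_q by nu(q) ||eta||, with
    q = p / (p - 1), turns it into
      |Cov(xi, eta)| (1/beta)^(1/p) / zeta(p) <= 2 ||xi|| ||eta||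
    for each admissible p, and the theorem is the supremum over p.

    Ibragimov's inequality is first proved for variables with finitely many
    values, xi = a(X) and eta = b(Y).  Then
      Cov(xi, eta) = sum_(i,j) a_i b_j c_ij,
      c_ij = P(X = i, Y = j) - P(X = i) P(Y = j)             ([Cov_finite]).
    Summing c_ij over the j in a set S gives the discrepancy
    P(X = i, Y in S) - P(X = i) P(Y in S), which is at most beta P(X = i) by
    definition of the mixing coefficient; splitting the row according to the
    sign of c_ij yields sum_j |c_ij| <= 2 beta P(X = i).  The columns obey the
    trivial bound sum_i |c_ij| <= 2 P(Y = j).  Hoelder's inequality on the
    index pairs with weights |c_ij| then distributes the factor beta to the
    exponent 1/p only ([bilinear_sum_le]).  Working with |c_ij| makes complex
    values as easy as real ones and keeps the constant 2.

    In general xi and eta are pointwise limits of finitely valued variables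
    measurable for the same sigma-algebras and dominated by xi and eta in
    modulus ([finite_valued_approx]).  Their norms do not exceed those of xi and
    eta, and their covariances converge by dominated convergence, the dominating
    functions |xi|, |eta| and |xi eta| being integrable by Hoelder's
    inequality ([cvg_normc_Cov]). *)

Set Implicit Arguments.
Unset Strict Implicit.
Unset Printing Implicit Defensive.

Import Order.TTheory GRing.Theory Num.Theory.
Import numFieldTopology.Exports numFieldNormedType.Exports.

Local Open Scope classical_set_scope.
Local Open Scope ring_scope.

(** * Finite weighted sums *)

Section finite_sums.
Context {R : realType}.

(** After dividing a and b by their weighted norms, this is Young's inequality
    summed against w; when one of the norms vanishes, so does every term on the
    left. *)
Lemma weighted_hoelder (I : finType) (w a b : I -> R) (p q : R) :
  (forall i, 0 <= w i) -> (forall i, 0 <= a i) -> (forall i, 0 <= b i) ->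
  0 < p -> 0 < q -> p^-1 + q^-1 = 1 ->
  \sum_i w i * (a i * b i) <=
    (\sum_i w i * a i `^ p) `^ p^-1 * (\sum_i w i * b i `^ q) `^ q^-1.
Proof.
move=> w0 a0 b0 p0 q0 pq.
have null (c : I -> R) (r : R) : 0 < r ->
    \sum_i w i * c i `^ r = 0 -> forall i, w i * c i = 0.
  move=> r0 /eqP; rewrite psumr_eq0 => [/allP cr i|i _]; last first.
    by rewrite mulr_ge0 ?powR_ge0.
  have := cr i; rewrite mem_index_enum => /(_ isT) /=.
  by rewrite mulf_eq0 powR_eq0 => /orP[/eqP->|/andP[/eqP-> _]];
    rewrite ?mul0r ?mulr0.
have scaled (c : I -> R) (r : R) : (forall i, 0 <= c i) -> 0 < r ->
    0 < \sum_i w i * c i `^ r ->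
    \sum_i w i * (c i / (\sum_i w i * c i `^ r) `^ r^-1) `^ r = 1.
  move=> c0 r0; set S := \sum_i _ => S0.
  have SE : ((S `^ r^-1)^-1) `^ r = S^-1.
    rewrite -powR_inv1 ?powR_ge0// -!powRrM (_ : _ * (_ * r) = -1) ?powR_inv1 ?ltW//.
    by field; rewrite gt_eqF.
  under eq_bigr => i _ do rewrite powRM ?invr_ge0 ?powR_ge0// SE mulrA.
  by rewrite -mulr_suml divff ?gt_eqF.
set A := \sum_i w i * a i `^ p; set B := \sum_i w i * b i `^ q.
have A0 : 0 <= A by apply: sumr_ge0 => i _; rewrite mulr_ge0 ?powR_ge0.
have B0 : 0 <= B by apply: sumr_ge0 => i _; rewrite mulr_ge0 ?powR_ge0.
have rhs0 : 0 <= A `^ p^-1 * B `^ q^-1 by rewrite mulr_ge0 ?powR_ge0.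
have [AE|An0] := eqVneq A 0.
  by rewrite big1 // => i _; rewrite mulrA (null _ _ p0 AE) mul0r.
have [BE|Bn0] := eqVneq B 0.
  by rewrite big1 // => i _; rewrite mulrCA (null _ _ q0 BE) mulr0.
have {A0 An0}Agt0 : 0 < A by rewrite lt_neqAle eq_sym An0.
have {B0 Bn0}Bgt0 : 0 < B by rewrite lt_neqAle eq_sym Bn0.
have sa := scaled a p a0 p0 Agt0; have sb := scaled b q b0 q0 Bgt0.
rewrite -/A in sa; rewrite -/B in sb; move: sa sb.
set s := A `^ p^-1; set u := B `^ q^-1.
have s0 : 0 < s by exact: powR_gt0.
have u0 : 0 < u by exact: powR_gt0.
move: s u s0 u0 {rhs0} => s u s0 u0 sa sb.
rewrite -[leRHS]mulr1 -(ler_pdivrMl _ _ (mulr_gt0 s0 u0)) mulr_sumr.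
rewrite (le_trans (y := \sum_i w i * ((a i / s) `^ p / p + (b i / u) `^ q / q)))//.
  apply: ler_sum => i _.
  have -> : (s * u)^-1 * (w i * (a i * b i)) = w i * (a i / s * (b i / u)).
    by rewrite [in RHS]mulrACA -invfM [RHS]mulrA [RHS]mulrC.
  by rewrite ler_wpM2l// conjugate_powR// divr_ge0// ltW.
under eq_bigr => i _ do rewrite mulrDr !mulrA.
by rewrite big_split/= -!mulr_suml sa sb !mul1r pq.
Qed.

(** Apply the hypothesis to the set where c is nonnegative and to the set where
    c is negative. *)
Lemma sum_normr_le_twice (J : finType) (c : J -> R) (K : R) :
  (forall S : {set J}, `|\sum_(j in S) c j| <= K) -> \sum_j `|c j| <= 2 * K.
Proof.
move=> cK; rewrite (bigID (fun j => 0 <= c j))/= mulr_natl mulr2n lerD//.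
  have := cK [set j | 0 <= c j]%SET; apply: le_trans; rewrite (le_trans _ (ler_norm _))//.
  rewrite le_eqVlt; apply/orP; left; apply/eqP.
  by apply: eq_big => j; rewrite ?inE// => /ger0_norm ->.
have := cK [set j | ~~ (0 <= c j)]%SET; apply: le_trans.
rewrite -normrN (le_trans _ (ler_norm _))// -sumrN.
rewrite le_eqVlt; apply/orP; left; apply/eqP.
by apply: eq_big => j; rewrite ?inE// -ltNge => /ltr0_norm ->.
Qed.

(** Hoelder's inequality with weights |c i j|: the function a sees only the row
    sums of |c| and b only its column sums, and the two factors 2 recombine since
    2^(1/p) 2^(1/q) = 2. *)
Lemma bilinear_sum_le (I J : finType) (c : I -> J -> R) (mu : I -> R)
    (nu : J -> R) (beta : R) (a : I -> R) (b : J -> R) (p q : R) :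
  0 <= beta -> (forall i, 0 <= mu i) -> (forall j, 0 <= nu j) ->
  (forall i, 0 <= a i) -> (forall j, 0 <= b j) ->
  0 < p -> 0 < q -> p^-1 + q^-1 = 1 ->
  (forall i, \sum_j `|c i j| <= 2 * (beta * mu i)) ->
  (forall j, \sum_i `|c i j| <= 2 * nu j) ->
  \sum_i \sum_j `|c i j| * (a i * b j) <=
    2 * beta `^ p^-1 * (\sum_i mu i * a i `^ p) `^ p^-1
      * (\sum_j nu j * b j `^ q) `^ q^-1.
Proof.
move=> be0 mu0 nu0 a0 b0 p0 q0 pq rows cols.
rewrite pair_big/=.
apply: (le_trans (@weighted_hoelder (I * J)%type (fun ij => `|c ij.1 ij.2|)
  (fun ij => a ij.1) (fun ij => b ij.2) p q _ _ _ p0 q0 pq)) => //.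
have Sa : 0 <= \sum_i mu i * a i `^ p.
  by apply: sumr_ge0 => i _; rewrite mulr_ge0 ?powR_ge0.
have Sb : 0 <= \sum_j nu j * b j `^ q.
  by apply: sumr_ge0 => i _; rewrite mulr_ge0 ?powR_ge0.
have -> : 2 * beta `^ p^-1 * (\sum_i mu i * a i `^ p) `^ p^-1
      * (\sum_j nu j * b j `^ q) `^ q^-1 =
   (2 * beta * \sum_i mu i * a i `^ p) `^ p^-1 *
   (2 * \sum_j nu j * b j `^ q) `^ q^-1.
  rewrite !powRM ?mulr_ge0//.
  transitivity (2 `^ p^-1 * 2 `^ q^-1 * beta `^ p^-1 *
    (\sum_i mu i * a i `^ p) `^ p^-1 * (\sum_j nu j * b j `^ q) `^ q^-1).
    by rewrite -powRD ?pq ?powRr1// oner_eq0.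
  by ring.
apply: ler_pM; rewrite ?powR_ge0//; apply: ge0_ler_powR.
- by rewrite invr_ge0 ltW.
- by rewrite nnegrE sumr_ge0// => i _; rewrite mulr_ge0 ?powR_ge0.
- by rewrite nnegrE !mulr_ge0.
- rewrite -(pair_big xpredT xpredT (fun i j => `|c i j| * a i `^ p))/=.
  rewrite mulr_sumr; apply: ler_sum => i _; rewrite -mulr_suml mulrA.
  by rewrite ler_wpM2r ?powR_ge0// -mulrA.
- by rewrite invr_ge0 ltW.
- by rewrite nnegrE sumr_ge0// => i _; rewrite mulr_ge0 ?powR_ge0.
- by rewrite nnegrE !mulr_ge0.
- rewrite -(pair_big xpredT xpredT (fun i j => `|c i j| * b j `^ q))/=.
  rewrite exchange_big/= mulr_sumr; apply: ler_sum => i _.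
  by rewrite -mulr_suml mulrA ler_wpM2r ?powR_ge0.
Qed.

Lemma normc_ge0 (z : R[i]) : 0 <= Normc.normc z.
Proof. by case: z => u v; exact: sqrtr_ge0. Qed.

Lemma normc_sum (I : finType) (f : I -> R[i]) :
  Normc.normc (\sum_i f i) <= \sum_i Normc.normc (f i).
Proof.
elim/big_rec2 : _ => [|i x y _ xy]; first by rewrite Normc.normc0.
by rewrite (le_trans (le_normcD _ _))// lerD2l.
Qed.

End finite_sums.

(** * Finitely valued random variables *)

Section finitely_valued.
Context d (T : measurableType d) (R : realType) (P : probability T R).
Implicit Types (F G : set_system T).

Let pr A : R := fine (P A).

Let prE A : measurable A -> P A = (pr A)%:E.
Proof. by move=> mA; rewrite fineK// fin_num_measure. Qed.

Let pr_ge0 A : 0 <= pr A.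
Proof. by rewrite fine_ge0. Qed.

(** The multiplicative form of the mixing bound also covers the events A of
    probability zero, for which both sides vanish. *)
Lemma prob_discrepancy_le F G A B : F `<=` measurable -> G `<=` measurable ->
  F A -> G B ->
  `|pr (A `&` B) - pr A * pr B| <= mixing_coef P F G * pr A.
Proof.
move=> Fm Gm FA GB.
have [mA mB] := (Fm _ FA, Gm _ GB).
have mAB := measurableI _ _ mA mB.
have AB_le : pr (A `&` B) <= pr A.
  by rewrite -lee_fin -!prE// le_measure ?inE//; exact: subIsetl.
have [A0|A0] := eqVneq (pr A) 0.
  have -> : pr (A `&` B) = 0.
    by apply/eqP; rewrite eq_le pr_ge0 andbT -A0.
  by rewrite A0 mul0r subrr normr0 mulr0.
have Apos : 0 < pr A by rewrite lt_neqAle eq_sym A0 pr_ge0.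
rewrite -ler_pdivrMr// -[X in _ / X]gtr0_norm// -normf_div.
apply: sup_upper_bound; last first.
  exists A, B; split => //; first by rewrite prE// lte_fin.
  by rewrite /cond_prob setIC -!/(pr _) mulrBl [pr A * _]mulrC mulfK.
split; first by eexists; exists A, B; split => //; rewrite prE// lte_fin.
exists 1 => _ [A' [B' [FA' GB' A'0 ->]]].
have [mA' mB'] := (Fm _ FA', Gm _ GB').
have pB' : pr B' <= 1 by rewrite -lee_fin -prE// probability_le1.
have c0 : 0 <= cond_prob P B' A' by rewrite divr_ge0// fine_ge0.
have c1 : cond_prob P B' A' <= 1.
  rewrite ler_pdivrMr ?mul1r; last by rewrite -lte_fin -prE.
  have mBA : measurable (B' `&` A') by exact: measurableI.
  by rewrite -lee_fin -!prE// le_measure ?inE//; exact: subIsetr.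
by rewrite ler_norml; have := pr_ge0 B'; rewrite /pr in pB' *; lra.
Qed.

Section expectation.
Context (I : finType) (X : T -> I).
Hypothesis mX : forall i, measurable (X @^-1` [set i]).

Let comp_finE (f : I -> R) :
  f \o X = fun w => \sum_i f i * \1_(X @^-1` [set i]) w.
Proof.
apply/funext => w /=; rewrite (bigD1 (X w))//= big1 ?addr0.
  by rewrite indicE mem_set// mulr1.
by move=> i iX; rewrite indicE memNset ?mulr0//= => /esym/eqP; rewrite (negbTE iX).
Qed.

Lemma measurable_fun_finite (f : I -> R) : measurable_fun setT (f \o X).
Proof.
rewrite comp_finE; apply: measurable_sum => i.
by apply: measurable_funM => //; exact: measurable_indic.
Qed.

Lemma expectation_finite (f : I -> R) :
  expectation P (f \o X) = (\sum_i f i * pr (X @^-1` [set i]))%:E.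
Proof.
rewrite unlock comp_finE/=.
under eq_integral do rewrite -sumEFin.
rewrite integral_sum//=.
  rewrite -sumEFin; apply: eq_bigr => i _.
  under eq_integral do rewrite EFinM.
  rewrite integralZl//; last exact: integrable_indic.
  by rewrite integral_indic// setIT EFinM -prE.
move=> i.
under eq_fun do rewrite EFinM.
by apply: integrableZl => //; exact: integrable_indic.
Qed.

Lemma cexpectation_finite (f : I -> R[i]) :
  cexpectation P (f \o X) = \sum_i f i * (pr (X @^-1` [set i]))%:C%C.
Proof.
rewrite /cexpectation.
rewrite (expectation_finite (fun i => complex.Re (f i))).
rewrite (expectation_finite (fun i => complex.Im (f i)))/=.
elim/big_rec3 : _ => // i x y z _ <-.
by case: (f i) => u v /=; simpc.
Qed.

End expectation.

Lemma sum_prob_preimage (J : finType) (Y : T -> J) (A : set T) (S : {set J}) :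
  measurable A -> (forall j, measurable (Y @^-1` [set j])) ->
  \sum_(j in S) pr (A `&` Y @^-1` [set j]) = pr (A `&` Y @^-1` [set` S]).
Proof.
move=> mA mY.
have mAY j : measurable (A `&` Y @^-1` [set j]) by exact: measurableI.
rewrite (_ : A `&` Y @^-1` [set` S] =
    \bigcup_(j in [set` S]) (A `&` Y @^-1` [set j])); last first.
  apply/seteqP; split => [w [Aw YwS]|w [j jS [Aw Ywj]]].
    by exists (Y w).
  by split => //; rewrite /preimage/= Ywj.
have tAY : trivIset [set` S] (fun j => A `&` Y @^-1` [set j]).
  by move=> j k _ _ [w [[_ <-] [_ <-]]].
rewrite /pr measure_fin_bigcup//.
rewrite -(@bigfs _ _ _ _ (index_enum J) (mem S))//=.
- by rewrite sum_fine// => j _; exact: fin_num_measure.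
- exact: index_enum_uniq.
- by move=> j _; rewrite mem_index_enum.
Qed.

Lemma sum_prob_preimageT (J : finType) (Y : T -> J) (A : set T) :
  measurable A -> (forall j, measurable (Y @^-1` [set j])) ->
  \sum_j pr (A `&` Y @^-1` [set j]) = pr A.
Proof.
move=> mA mY; rewrite -[RHS](_ : pr (A `&` Y @^-1` [set` [set: J]%SET]) = _).
  by rewrite -sum_prob_preimage//; apply: eq_bigl => j; rewrite inE.
by congr (pr _); apply/seteqP; split => [w []//|w Aw]; split => //=; rewrite inE.
Qed.

(** E(a(X) b(Y)) is computed from the joint law, that is, from the law of the
    finitely valued variable (X, Y). *)
Lemma Cov_finite (I J : finType) (X : T -> I) (Y : T -> J)
    (a : I -> R[i]) (b : J -> R[i]) :
  (forall i, measurable (X @^-1` [set i])) ->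
  (forall j, measurable (Y @^-1` [set j])) ->
  Cov P (a \o X) (b \o Y) = \sum_i \sum_j a i * b j *
    (pr (X @^-1` [set i] `&` Y @^-1` [set j]) -
     pr (X @^-1` [set i]) * pr (Y @^-1` [set j]))%:C%C.
Proof.
move=> mX mY; rewrite /Cov.
rewrite (cexpectation_finite mX) (cexpectation_finite mY).
pose Z w := (X w, Y w).
have ZE ij : Z @^-1` [set ij] = X @^-1` [set ij.1] `&` Y @^-1` [set ij.2].
  by case: ij => i j; apply/seteqP; split => w; rewrite /Z/=; [case|case=> -> ->].
rewrite (@cexpectation_finite _ Z _ (fun ij => a ij.1 * b ij.2)); last first.
  by move=> ij; rewrite ZE; exact: measurableI.
under eq_bigr => ij _ do rewrite ZE.
rewrite -(pair_big xpredT xpredT (fun i j => a i * b j *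
  (pr (X @^-1` [set i] `&` Y @^-1` [set j]))%:C%C))/=.
rewrite big_distrl -sumrB; apply: eq_bigr => i _ /=.
rewrite mulr_sumr -sumrB; apply: eq_bigr => j _.
by rewrite rmorphB rmorphM/= mulrBr mulrACA.
Qed.

(** Ibragimov's inequality for finitely valued variables: the mixing
    coefficient bounds the rows of the matrix of discrepancies, and the columns
    are bounded by the triangle inequality. *)
Lemma Cov_finite_le (I J : finType) (X : T -> I) (Y : T -> J)
    (a : I -> R[i]) (b : J -> R[i]) F G (p q : R) :
  F `<=` measurable -> G `<=` measurable ->
  (forall S : set I, F (X @^-1` S)) -> (forall S : set J, G (Y @^-1` S)) ->
  0 <= mixing_coef P F G -> 0 < p -> 0 < q -> p^-1 + q^-1 = 1 ->
  Normc.normc (Cov P (a \o X) (b \o Y)) <=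
    2 * mixing_coef P F G `^ p^-1 *
    (\sum_i pr (X @^-1` [set i]) * Normc.normc (a i) `^ p) `^ p^-1 *
    (\sum_j pr (Y @^-1` [set j]) * Normc.normc (b j) `^ q) `^ q^-1.
Proof.
move=> Fm Gm FX GY be0 p0 q0 pq.
have mX i : measurable (X @^-1` [set i]) by apply: Fm.
have mY i : measurable (Y @^-1` [set i]) by apply: Gm.
rewrite Cov_finite//.
pose c i j := pr (X @^-1` [set i] `&` Y @^-1` [set j]) -
  pr (X @^-1` [set i]) * pr (Y @^-1` [set j]).
apply: (le_trans _ (@bilinear_sum_le R I J c (fun i => pr (X @^-1` [set i]))
    (fun j => pr (Y @^-1` [set j])) _ (fun i => Normc.normc (a i))
    (fun j => Normc.normc (b j)) p q be0 _ _
    (fun i => normc_ge0 _) (fun j => normc_ge0 _) p0 q0 pq _ _)) => //=.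
- apply: (le_trans (normc_sum _)); apply: ler_sum => i _.
  apply: (le_trans (normc_sum _)); apply: ler_sum => j _.
  rewrite !Normc.normcM mulrC; apply: ler_wpM2r; first by rewrite mulr_ge0 ?normc_ge0.
  by rewrite /Normc.normc/= expr0n/= addr0 sqrtr_sqr.
(* Rows: a partial row sum is the discrepancy of the events X = i, Y in S. *)
- move=> i; apply: sum_normr_le_twice => S; rewrite sumrB -mulr_sumr.
  rewrite sum_prob_preimage//.
  rewrite (_ : \sum_(j in S) pr (Y @^-1` [set j]) = pr (Y @^-1` [set` S])).
    by apply: prob_discrepancy_le.
  have := @sum_prob_preimage _ Y setT S measurableT mY.
  by rewrite setTI => <-; apply: eq_bigr => j _; rewrite setTI.
(* Columns: P(X = i, Y = j) and P(X = i) P(Y = j) both sum to P(Y = j)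
   over i. *)
- move=> j.
  apply: (@le_trans _ _ (\sum_i (pr (Y @^-1` [set j] `&` X @^-1` [set i]) +
     pr (Y @^-1` [set j]) * pr (X @^-1` [set i])))).
    apply: ler_sum => i _; rewrite (le_trans (ler_normB _ _))//.
    by rewrite ger0_norm// ger0_norm ?mulr_ge0// mulrC setIC.
  rewrite big_split/= -mulr_sumr sum_prob_preimageT//.
  rewrite (_ : \sum_i pr (X @^-1` [set i]) = 1).
    by rewrite mulr1 mulr_natl mulr2n.
  have := @sum_prob_preimageT _ X setT measurableT mX.
  rewrite [RHS](_ : _ = 1); last by rewrite /pr probability_setT.
  by move=> <-; apply: eq_bigr => i _; rewrite setTI.
Qed.

End finitely_valued.

(** * Approximation by finitely valued variables *)

Section approximation.
Context {R : realType}.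
Import HBSimple HBNNSimple.

(** Approximating the identity of the line, rather than a given random variable,
    makes every approximation h n (X) of X measurable for whatever
    sigma-algebra X is measurable for, without changing the measurable
    structure on the sample space. *)
Lemma finite_valued_approx_id : exists h : nat -> R -> R,
  [/\ forall n, measurable_fun setT (h n),
      forall n, finite_set (range (h n)),
      forall n x, `|h n x| <= `|x| &
      forall x, h n x @[n --> \oo] --> x].
Proof.
pose f := EFin \o (fun x : R => Num.max x 0).
have mf : measurable_fun setT f.
  by apply/measurable_EFinP; apply: measurable_maxr;
    [exact: measurable_id|exact: measurable_cst].
pose u n : {nnsfun R >-> R} := nnsfun_approx measurableT mf n.
have f0 x : setT x -> (0 <= f x)%E by move=> _; rewrite lee_fin le_max lexx orbT.
have u_ge0 n x : 0 <= u n x by [].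
have u_le n x : u n x <= Num.max x 0.
  by rewrite -lee_fin -[leRHS]/(f x) /u nnsfun_approxE;
    apply: (le_approx (D := setT) (f := f)).
have u_cvg x : u n x @[n --> \oo] --> Num.max x 0.
  by have /fine_cvg := cvg_nnsfun_approx measurableT mf f0 (x := x) Logic.I.
(* With u n approximating the positive part from below, at most one of u n x
   and u n (- x) is nonzero, so the difference never exceeds x in modulus. *)
exists (fun n x => u n x - u n (- x)); split.
- move=> n; apply: measurable_funB => //.
  by apply: measurableT_comp => //; exact: measurable_oppr.
- move=> n; have fu := fimfunP (u n).
  apply: (@sub_finite_set _ _
    ((fun xy => xy.1 - xy.2) @` (range (u n) `*` range (u n)))).
    by move=> _ [x _ <-]; exists (u n x, u n (- x)) => //=; split; eexists.
  by apply: finite_image; exact: finite_setX.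
- move=> n x.
  have := u_ge0 n x; have := u_le n x; have := u_ge0 n (- x); have := u_le n (- x).
  have [x0|x0] := leP 0 x.
    have -> : Num.max (- x) 0 = 0 by apply/max_idPr; rewrite oppr_le0.
    by rewrite (ger0_norm x0) ler_norml; lra.
  have -> : Num.max (- x) 0 = - x by apply/max_idPl; rewrite oppr_ge0 ltW.
  by rewrite (ltr0_norm x0) ler_norml; lra.
- move=> x; rewrite [X in _ --> X](_ : x = Num.max x 0 - Num.max (- x) 0).
    by apply: cvgB; exact: u_cvg.
  have [x0|x0] := leP 0 x.
    by rewrite (max_idPr _) ?subr0 ?oppr_le0//.
  by rewrite (max_idPl _) ?opprK ?add0r// ?oppr_ge0 ltW.
Qed.

(** Coding the values by a finite type lets expectations become sums over
    that type. *)
Lemma finite_range_factor (h : R -> R) :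
  measurable_fun setT h -> finite_set (range h) ->
  exists (I : finType) (Q : R -> I) (v : I -> R),
    (forall i, measurable (Q @^-1` [set i])) /\ h = v \o Q.
Proof.
move=> mh fh.
have hin x : h x \in fset_set (range h) by rewrite in_fset_set//; apply/mem_set; exists x.
exists (fset_set (range h)), (fun x => FSetSub (hin x)), val; split => // i.
rewrite (_ : _ @^-1` _ = setT `&` h @^-1` [set val i]); first exact: mh.
rewrite setTI; apply/seteqP; split => x /=; first by move=> <-.
by move=> hx; apply: val_inj.
Qed.

End approximation.

Section complex_approximation.
Context d (T : measurableType d) (R : realType).
Implicit Types (F : set_system T) (xi : T -> R[i]).

Lemma le_normc (y z : R[i]) : `|complex.Re y| <= `|complex.Re z| ->
  `|complex.Im y| <= `|complex.Im z| -> Normc.normc y <= Normc.normc z.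
Proof.
case: y z => [a b] [u v] /= au bv.
by rewrite ler_wsqrtr// lerD// -[leLHS]real_normK ?num_real// -[leRHS]real_normK
  ?num_real// lerXn2r// nnegrE.
Qed.

(** The real and imaginary parts are quantized separately; truncation towards
    zero in each coordinate does not increase the modulus. *)
Lemma finite_valued_approx F xi : sigma_algebra setT F -> measurable_wrt F xi ->
  exists (I : nat -> finType) (X : forall n, T -> I n) (a : forall n, I n -> R[i]),
    [/\ forall n (S : set (I n)), F (X n @^-1` S),
        forall n w, Normc.normc (a n (X n w)) <= Normc.normc (xi w),
        forall w, complex.Re (a n (X n w)) @[n --> \oo] --> complex.Re (xi w) &
        forall w, complex.Im (a n (X n w)) @[n --> \oo] --> complex.Im (xi w)].
Proof.
move=> sF [Fre Fim].
have [h [mh fh hle hcvg]] := finite_valued_approx_id (R := R).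
have factor n : {c : {I : finType & ((R -> I) * (I -> R))%type} |
    (forall i, measurable ((projT2 c).1 @^-1` [set i])) /\
    h n = (projT2 c).2 \o (projT2 c).1}.
  apply: cid; have [I [Q [v [mQ hE]]]] := finite_range_factor (mh n) (fh n).
  by exists (existT _ I (Q, v)).
pose J n : finType := projT1 (sval (factor n)).
pose Q n : R -> J n := (projT2 (sval (factor n))).1.
pose v n : J n -> R := (projT2 (sval (factor n))).2.
have mQ n i : measurable (Q n @^-1` [set i]) by exact: (svalP (factor n)).1.
have vQ n x : v n (Q n x) = h n x by rewrite (svalP (factor n)).2.
exists (fun n => (J n * J n)%type : finType).
exists (fun n w => (Q n (complex.Re (xi w)), Q n (complex.Im (xi w)))).
exists (fun n ij => Complex (v n ij.1) (v n ij.2)); split.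
- move=> n S.
  have FE := measurable_g_measurableTypeE sF.
  rewrite -FE (_ : _ @^-1` S = \bigcup_(ij in S)
    ((fun w => complex.Re (xi w)) @^-1` (Q n @^-1` [set ij.1]) `&`
     (fun w => complex.Im (xi w)) @^-1` (Q n @^-1` [set ij.2]))); last first.
    apply/seteqP; split => [w Sw|w [[i j] Sij [/= Qi Qj]]];
      last by rewrite /preimage/= Qi Qj.
    by eexists; first exact: Sw.
  apply: fin_bigcup_measurable => [|[i j] _]; first exact: finite_finset.
  apply: measurableI; rewrite FE.
    by apply: Fre; exists (Q n @^-1` [set i]) => //; rewrite setTI.
  by apply: Fim; exists (Q n @^-1` [set j]) => //; rewrite setTI.
- by move=> n w; apply: le_normc; rewrite /= vQ.
- by move=> w /=; under eq_fun do rewrite vQ; exact: hcvg.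
- by move=> w /=; under eq_fun do rewrite vQ; exact: hcvg.
Qed.

End complex_approximation.

(** * The covariance inequality for conjugate exponents *)

Section Lp_covariance.
Context d (T : measurableType d) (R : realType) (P : probability T R).
Implicit Types (F G : set_system T) (xi eta f g : T -> R[i]).

Lemma measurable_wrtE f : measurable_wrt measurable f <->
  measurable_fun setT (fun w => complex.Re (f w)) /\
  measurable_fun setT (fun w => complex.Im (f w)).
Proof.
have mE (h : T -> R) :
    preimage_set_system setT h measurable `<=` measurable <->
    measurable_fun setT h.
  split=> [hm _ Y mY|mh _ [Y mY <-]]; last exact: mh.
  by apply: hm; exists Y.
by rewrite /measurable_wrt !mE.
Qed.

Lemma measurable_wrtS F f : F `<=` measurable ->
  measurable_wrt F f -> measurable_wrt measurable f.
Proof. by move=> Fm [fr fi]; split=> A; [move/fr/Fm|move/fi/Fm]. Qed.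

Lemma measurable_wrt_finite (I : finType) (X : T -> I) (a : I -> R[i]) :
  (forall i, measurable (X @^-1` [set i])) -> measurable_wrt measurable (a \o X).
Proof.
move=> mX; apply/measurable_wrtE; split.
- exact: (measurable_fun_finite mX (fun i => complex.Re (a i))).
- exact: (measurable_fun_finite mX (fun i => complex.Im (a i))).
Qed.

Lemma ReM (x y : R[i]) : complex.Re (x * y) =
  complex.Re x * complex.Re y - complex.Im x * complex.Im y.
Proof. by case: x y => [a b] [u v]. Qed.

Lemma ImM (x y : R[i]) : complex.Im (x * y) =
  complex.Re x * complex.Im y + complex.Im x * complex.Re y.
Proof. by case: x y => [a b] [u v]. Qed.

Lemma normcE_ReIm (z : R[i]) :
  Normc.normc z = Num.sqrt (complex.Re z ^+ 2 + complex.Im z ^+ 2).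
Proof. by case: z. Qed.

Lemma measurable_wrtM f g : measurable_wrt measurable f ->
  measurable_wrt measurable g ->
  measurable_wrt measurable (fun w => f w * g w).
Proof.
move=> /measurable_wrtE[fr fi] /measurable_wrtE[gr gi]; apply/measurable_wrtE; split.
- under eq_fun do rewrite ReM.
  by apply: measurable_funB; exact: measurable_funM.
- under eq_fun do rewrite ImM.
  by apply: measurable_funD; exact: measurable_funM.
Qed.

Lemma measurable_normc f : measurable_wrt measurable f ->
  measurable_fun setT (fun w => Normc.normc (f w)).
Proof.
move=> /measurable_wrtE[fr fi]; under eq_fun do rewrite normcE_ReIm.
apply: (measurableT_comp (f := @Num.sqrt R)).
  by apply: continuous_measurable_fun; exact: sqrt_continuous.
by apply: measurable_funD; exact: measurable_funX.
Qed.

Lemma normr_Re_le (z : R[i]) : `|complex.Re z| <= Normc.normc z.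
Proof. by rewrite normcE_ReIm -sqrtr_sqr ler_wsqrtr// lerDl sqr_ge0. Qed.

Lemma normr_Im_le (z : R[i]) : `|complex.Im z| <= Normc.normc z.
Proof. by rewrite normcE_ReIm -sqrtr_sqr ler_wsqrtr// lerDr sqr_ge0. Qed.

Lemma le_Lp_norm f g (p : R) : 0 < p ->
  measurable_wrt measurable f -> measurable_wrt measurable g ->
  (forall w, Normc.normc (f w) <= Normc.normc (g w)) ->
  (Lp_norm P p f <= Lp_norm P p g)%E.
Proof.
move=> p0 mf mg fg; rewrite /Lp_norm unlock/=.
have mp (h : T -> R[i]) : measurable_wrt measurable h ->
    measurable_fun setT (fun w => (`|Normc.normc (h w)| `^ p)%:E).
  move=> mh; under eq_fun do rewrite ger0_norm ?normc_ge0//.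
  apply/measurable_EFinP.
  exact: (measurableT_comp (measurable_powR p) (measurable_normc mh)).
apply: gt0_ler_poweR.
- by rewrite invr_ge0 ltW.
- by rewrite in_itv/= leey andbT; apply: integral_ge0 => w _; rewrite lee_fin powR_ge0.
- by rewrite in_itv/= leey andbT; apply: integral_ge0 => w _; rewrite lee_fin powR_ge0.
apply: ge0_le_integral => //.
- exact: (mp f).
- exact: (mp g).
move=> w _; rewrite lee_fin; apply: ge0_ler_powR; [exact: ltW| | |];
  rewrite ?nnegrE//.
by rewrite !ger0_norm ?normc_ge0.
Qed.

Lemma Lp_norm_finite (I : finType) (X : T -> I) (a : I -> R[i]) (p : R) :
  (forall i, measurable (X @^-1` [set i])) ->
  Lp_norm P p (a \o X) =
  ((\sum_i fine (P (X @^-1` [set i])) * Normc.normc (a i) `^ p) `^ p^-1)%:E.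
Proof.
move=> mX; rewrite /Lp_norm unlock/=.
have := expectation_finite P mX (fun i => Normc.normc (a i) `^ p).
rewrite unlock => E.
under eq_integral do rewrite ger0_norm ?normc_ge0//.
rewrite E poweR_EFin; congr ((_ `^ _)%:E).
by apply: eq_bigr => i _; rewrite mulrC.
Qed.

Lemma integrable_normcM f g (p q : R) :
  measurable_wrt measurable f -> measurable_wrt measurable g ->
  0 < p -> 0 < q -> p^-1 + q^-1 = 1 ->
  (Lp_norm P p f < +oo)%E -> (Lp_norm P q g < +oo)%E ->
  P.-integrable setT (fun w => (Normc.normc (f w) * Normc.normc (g w))%:E).
Proof.
move=> mf mg p0 q0 pq fp gq.
have mnf := measurable_normc mf; have mng := measurable_normc mg.
apply/integrableP; split; first by apply/measurable_EFinP; exact: measurable_funM.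
have := hoelder P mnf mng p0 q0 pq; rewrite Lnorm1/= => /le_lt_trans; apply.
by rewrite lte_mul_pinfty ?Lnorm_ge0// ge0_fin_numE ?Lnorm_ge0.
Qed.

(** Hoelder's inequality against the constant 1, which has norm 1 because the
    total mass is 1. *)
Lemma integrable_normc f (p q : R) : measurable_wrt measurable f ->
  0 < p -> 0 < q -> p^-1 + q^-1 = 1 -> (Lp_norm P p f < +oo)%E ->
  P.-integrable setT (fun w => (Normc.normc (f w))%:E).
Proof.
move=> mf p0 q0 pq fp.
pose one : T -> R[i] := fun=> 1.
have n1 : Normc.normc (1 : R[i]) = 1 by exact: Normc.normc1.
have m1 : measurable_wrt measurable one.
  by apply/measurable_wrtE; split; exact: measurable_cst.
have : (Lp_norm P q one < +oo)%E.
  rewrite /Lp_norm [X in Lnorm _ _ X](_ : _ = cst 1%E); last first.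
    by apply/funext => w; rewrite n1.
  rewrite Lnorm_cst1 [X in (X `^ _)%E](_ : _ = 1%E) ?poweR1e ?ltry//.
  exact: probability_setT.
move=> /(integrable_normcM mf m1 p0 q0 pq fp).
by under eq_fun do rewrite n1 mulr1.
Qed.

Lemma cvg_fine_expectation (f_ : nat -> T -> R) (f g : T -> R) :
  (forall n, measurable_fun setT (f_ n)) -> measurable_fun setT f ->
  (forall w, f_ n w @[n --> \oo] --> f w) ->
  (forall n w, `|f_ n w| <= g w) ->
  P.-integrable setT (EFin \o g) ->
  fine (expectation P (f_ n)) @[n --> \oo] --> fine (expectation P f).
Proof.
move=> mf_ mf f_f fg ig; rewrite unlock.
have [intf _ cvgf] : [/\ P.-integrable setT (EFin \o f),
   [sequence \int[P]_(x in setT) `|(f_ n x)%:E - (f x)%:E|]_n @ \oo --> 0%E &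
   [sequence \int[P]_(x in setT) (f_ n x)%:E]_n @ \oo --> \int[P]_(x in setT) (f x)%:E]%E.
  apply: (@dominated_convergence _ _ _ P setT measurableT (fun n => EFin \o f_ n)
    (EFin \o f) (EFin \o g)) => //.
  - by move=> n; exact/measurable_EFinP.
  - exact/measurable_EFinP.
  - by apply: aeW => w _ /=; apply: cvg_EFin; [exact: nearW|exact: f_f].
  - by apply: aeW => w n _ /=; rewrite lee_fin.
apply: fine_cvg; rewrite fineK; first exact: cvgf.
exact: integrable_fin_num.
Qed.

Lemma cvg_cexpectation (f_ : nat -> T -> R[i]) f (g : T -> R) :
  (forall n, measurable_wrt measurable (f_ n)) -> measurable_wrt measurable f ->
  (forall w, complex.Re (f_ n w) @[n --> \oo] --> complex.Re (f w)) ->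
  (forall w, complex.Im (f_ n w) @[n --> \oo] --> complex.Im (f w)) ->
  (forall n w, Normc.normc (f_ n w) <= g w) ->
  P.-integrable setT (EFin \o g) ->
  complex.Re (cexpectation P (f_ n)) @[n --> \oo] --> complex.Re (cexpectation P f) /\
  complex.Im (cexpectation P (f_ n)) @[n --> \oo] --> complex.Im (cexpectation P f).
Proof.
move=> mf_ /measurable_wrtE[mr mi] cr ci fg ig.
split; apply: cvg_fine_expectation ig => //.
- by move=> n; have /measurable_wrtE[] := mf_ n.
- by move=> n w; exact: le_trans (normr_Re_le _) (fg _ _).
- by move=> n; have /measurable_wrtE[] := mf_ n.
- by move=> n w; exact: le_trans (normr_Im_le _) (fg _ _).
Qed.

(** The three expectations in the covariance converge by dominated convergence,
    dominated by |f|, |g| and |f| |g|. *)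
Lemma cvg_normc_Cov (f_ g_ : nat -> T -> R[i]) f g (p q : R) :
  (forall n, measurable_wrt measurable (f_ n)) -> measurable_wrt measurable f ->
  (forall n, measurable_wrt measurable (g_ n)) -> measurable_wrt measurable g ->
  (forall w, complex.Re (f_ n w) @[n --> \oo] --> complex.Re (f w)) ->
  (forall w, complex.Im (f_ n w) @[n --> \oo] --> complex.Im (f w)) ->
  (forall w, complex.Re (g_ n w) @[n --> \oo] --> complex.Re (g w)) ->
  (forall w, complex.Im (g_ n w) @[n --> \oo] --> complex.Im (g w)) ->
  (forall n w, Normc.normc (f_ n w) <= Normc.normc (f w)) ->
  (forall n w, Normc.normc (g_ n w) <= Normc.normc (g w)) ->
  0 < p -> 0 < q -> p^-1 + q^-1 = 1 ->
  (Lp_norm P p f < +oo)%E -> (Lp_norm P q g < +oo)%E ->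
  Normc.normc (Cov P (f_ n) (g_ n)) @[n --> \oo] --> Normc.normc (Cov P f g).
Proof.
move=> mf_ mf mg_ mg fr fi gr gi le_f le_g p0 q0 pq fp gq.
have qp : q^-1 + p^-1 = 1 by rewrite addrC.
have [Efr Efi] := cvg_cexpectation mf_ mf fr fi le_f (integrable_normc mf p0 q0 pq fp).
have [Egr Egi] := cvg_cexpectation mg_ mg gr gi le_g (integrable_normc mg q0 p0 qp gq).
have [Efgr Efgi] :
  complex.Re (cexpectation P (fun w => f_ n w * g_ n w)) @[n --> \oo] -->
    complex.Re (cexpectation P (fun w => f w * g w)) /\
  complex.Im (cexpectation P (fun w => f_ n w * g_ n w)) @[n --> \oo] -->
    complex.Im (cexpectation P (fun w => f w * g w)).
  apply: (@cvg_cexpectation (fun n w => f_ n w * g_ n w) _ _ _ _ _ _ _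
    (integrable_normcM mf mg p0 q0 pq fp gq)).
  - by move=> n; exact: measurable_wrtM.
  - exact: measurable_wrtM.
  - move=> w; under eq_fun do rewrite ReM; rewrite ReM.
    by apply: cvgB; exact: cvgM.
  - move=> w; under eq_fun do rewrite ImM; rewrite ImM.
    by apply: cvgD; exact: cvgM.
  - by move=> n w; rewrite Normc.normcM ler_pM ?normc_ge0.
have ReB (x y : R[i]) : complex.Re (x - y) = complex.Re x - complex.Re y.
  by case: x y => [? ?] [].
have ImB (x y : R[i]) : complex.Im (x - y) = complex.Im x - complex.Im y.
  by case: x y => [? ?] [].
have CovRe : complex.Re (Cov P (f_ n) (g_ n)) @[n --> \oo] -->
    complex.Re (Cov P f g).
  under eq_fun do rewrite ReB ReM; rewrite ReB ReM.
  by apply: cvgB => //; apply: cvgB; exact: cvgM.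
have CovIm : complex.Im (Cov P (f_ n) (g_ n)) @[n --> \oo] -->
    complex.Im (Cov P f g).
  under eq_fun do rewrite ImB ImM; rewrite ImB ImM.
  by apply: cvgB => //; apply: cvgD; exact: cvgM.
have sqr2 : complex.Re (Cov P (f_ n) (g_ n)) ^+ 2 +
    complex.Im (Cov P (f_ n) (g_ n)) ^+ 2 @[n --> \oo] -->
    complex.Re (Cov P f g) ^+ 2 + complex.Im (Cov P f g) ^+ 2.
  by apply: cvgD; [exact: (cvgM CovRe CovRe)|exact: (cvgM CovIm CovIm)].
under eq_fun do rewrite normcE_ReIm; rewrite normcE_ReIm.
exact: (cvg_comp _ _ sqr2 (@sqrt_continuous R _)).
Qed.

(** Ibragimov's inequality: the finitely valued case bounds the covariances of
    the approximations uniformly, since their norms do not exceed those of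
    xi and eta, and the bound passes to the limit. *)
Lemma Cov_Lp_le F G xi eta (p q : R) :
  is_sub_sigma_algebra F -> is_sub_sigma_algebra G ->
  measurable_wrt F xi -> measurable_wrt G eta ->
  0 <= mixing_coef P F G -> 0 < p -> 0 < q -> p^-1 + q^-1 = 1 ->
  (Lp_norm P p xi < +oo)%E -> (Lp_norm P q eta < +oo)%E ->
  Normc.normc (Cov P xi eta) <=
    2 * mixing_coef P F G `^ p^-1 * fine (Lp_norm P p xi) * fine (Lp_norm P q eta).
Proof.
move=> [sF Fm] [sG Gm] mxi meta be0 p0 q0 pq xip etaq.
have mx := measurable_wrtS Fm mxi; have my := measurable_wrtS Gm meta.
have [I [X [a [FX le_a ar ai]]]] := finite_valued_approx sF mxi.
have [J [Y [b [GY le_b br bi]]]] := finite_valued_approx sG meta.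
have mX n i : measurable (X n @^-1` [set i]) by exact/Fm/FX.
have mY n j : measurable (Y n @^-1` [set j]) by exact/Gm/GY.
have ma n := measurable_wrt_finite (a n) (mX n).
have mb n := measurable_wrt_finite (b n) (mY n).
apply: (cvgr_to_le (cvg_normc_Cov ma mx mb my ar ai br bi le_a le_b p0 q0 pq xip etaq)).
apply: nearW => n.
apply: (le_trans (Cov_finite_le _ _ Fm Gm (FX n) (GY n) be0 p0 q0 pq)).
have fine_le f r (s : R) : (Lp_norm P r f < +oo)%E -> (s%:E <= Lp_norm P r f)%E ->
    s <= fine (Lp_norm P r f).
  by move=> foo; rewrite -lee_fin fineK// ge0_fin_numE ?Lnorm_ge0.
apply: ler_pM; rewrite ?mulr_ge0 ?powR_ge0//.
- rewrite ler_wpM2l ?mulr_ge0 ?powR_ge0//.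
  by apply: fine_le => //; rewrite -(Lp_norm_finite _ _ (mX n));
    exact: (le_Lp_norm p0 (ma n) mx (le_a n)).
- by apply: fine_le => //; rewrite -(Lp_norm_finite _ _ (mY n));
  exact: (le_Lp_norm q0 (mb n) my (le_b n)).
Qed.

End Lp_covariance.

(** * Grand Lebesgue norms *)

(** Positivity matters because it excludes the product 0 * +oo in zeta: when
    zeta(p) is finite, both factors are. *)
Lemma Psi_gt0 (R : realType) (psi : R -> \bar R) (p : R) :
  Psi psi -> (0 < psi p)%E.
Proof.
move=> [b [_ [I [_ _ _ inf0 psiy]]]].
have [Ip|/psiy-> //] := pselect (I p).
by apply: lt_le_trans inf0 _; apply: ereal_inf_lbound; exists p.
Qed.

Lemma conjugate_exponent (R : realType) (p : R) : 1 < p ->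
  let q := p / (p - 1) in 1 < q /\ p^-1 + q^-1 = 1.
Proof.
move=> p1 q; have p10 : 0 < p - 1 by rewrite subr_gt0.
split; first by rewrite ltr_pdivlMr// mul1r ltrBlDr ltrDl.
by rewrite /q invf_div mulrBl divff ?gt_eqF ?(lt_trans _ p1)// mul1r addrC subrK.
Qed.

Section grand_Lebesgue.
Context d (T : measurableType d) (R : realType) (P : probability T R).

(** The norm is returned as a real number so that the rest of the argument can
    take place in the real field. *)
Lemma Lp_norm_le_GLS (psi : R -> \bar R) (xi : T -> R[i]) (p : R) :
  (0 < psi p)%E -> (psi p < +oo)%E -> 1 <= p -> (GLS_norm P psi xi < +oo)%E ->
  exists K, [/\ GLS_norm P psi xi = K%:E, 0 <= K,
    (Lp_norm P p xi < +oo)%E & fine (Lp_norm P p xi) <= K * fine (psi p)].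
Proof.
move=> psi0 psioo p1 normoo.
have psifin : psi p \is a fin_num by rewrite ge0_fin_numE// ltW.
have psip : 0 < fine (psi p) by rewrite -lte_fin fineK.
have le_norm : (Lp_norm P p xi / psi p <= GLS_norm P psi xi)%E.
  by apply: ereal_sup_ubound; exists p.
have Lp0 : (0 <= Lp_norm P p xi)%E by exact: Lnorm_ge0.
have quot0 : (0 <= Lp_norm P p xi / psi p)%E.
  by rewrite mule_ge0// inve_ge0 ltW.
have Kfin : GLS_norm P psi xi \is a fin_num.
  by rewrite ge0_fin_numE// (le_trans quot0 le_norm).
have Lp_le : (Lp_norm P p xi <= (fine (GLS_norm P psi xi) * fine (psi p))%:E)%E.
  rewrite EFinM (fineK Kfin) -lee_pdivrMr//.
  by move: le_norm; rewrite -{1}(fineK psifin) inver gt_eqF.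
exists (fine (GLS_norm P psi xi)); split.
- by rewrite fineK.
- by rewrite -lee_fin fineK// (le_trans quot0 le_norm).
- by rewrite (le_lt_trans Lp_le)// ltry.
- by rewrite -lee_fin fineK// ge0_fin_numE// (le_lt_trans Lp_le)// ltry.
Qed.

End grand_Lebesgue.

Local Open Scope ereal_scope.

Theorem theorem3p1 (d : measure_display) (T : measurableType d) (R : realType)
    (P : probability T R) (psi nu : R -> \bar R) (F G : set_system T)
    (xi eta : T -> R[i]) :
  Psi psi -> Psi nu ->
  is_sub_sigma_algebra F -> is_sub_sigma_algebra G ->
  (0 < mixing_coef P F G)%R ->
  GLS P psi xi -> measurable_wrt F xi ->
  GLS P nu eta -> measurable_wrt G eta ->
  (Normc.normc (Cov P xi eta))%:E <=
    div_or_pinfty (2%:E * GLS_norm P psi xi * GLS_norm P nu eta)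
      (fundamental_function (zeta_fun psi nu) (mixing_coef P F G)^-1%R).
Proof.
move=> Ppsi Pnu sF sG be0 [_ xioo] mxi [_ etaoo] meta.
set be := mixing_coef P F G in be0 *; set zeta := zeta_fun psi nu.
set phi := fundamental_function _ _; set c := Normc.normc _.
rewrite /div_or_pinfty; case: ifPn => [_|phi_neq0]; first exact: leey.
have c0 : (0 <= c)%R by exact: normc_ge0.
have bound (p : R) : (1 < p)%R -> zeta p < +oo ->
    exists K L, [/\ GLS_norm P psi xi = K%:E, GLS_norm P nu eta = L%:E,
      (0 <= K)%R, (0 <= L)%R &
      (be^-1 `^ p^-1)%:E / zeta p * c%:E <= (2 * K * L)%:E].
  move=> p1 zetaoo; have [q1 pq] := conjugate_exponent p1.
  set q := (p / (p - 1))%R in q1 pq.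
  have psi0 := Psi_gt0 p Ppsi; have nu0 := Psi_gt0 q Pnu.
  have psioo : psi p < +oo.
    rewrite ltey; apply: contraTN zetaoo => /eqP psiE.
    by rewrite /zeta /zeta_fun psiE gt0_mulye// ltxx.
  have nuoo : nu q < +oo.
    rewrite ltey; apply: contraTN zetaoo => /eqP nuE.
    by rewrite /zeta /zeta_fun nuE gt0_muley// ltxx.
  have [K [KE K0 xip leK]] := Lp_norm_le_GLS psi0 psioo (ltW p1) xioo.
  have [L [LE L0 etaq leL]] := Lp_norm_le_GLS nu0 nuoo (ltW q1) etaoo.
  exists K, L; split => //.
  have p0 : (0 < p)%R by exact: lt_trans p1.
  have q0 : (0 < q)%R by exact: lt_trans q1.
  have := Cov_Lp_le sF sG mxi meta (ltW be0) p0 q0 pq xip etaq.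
  rewrite -/be -/c => cov_le.
  have psifin : psi p \is a fin_num by rewrite ge0_fin_numE// ltW.
  have nufin : nu q \is a fin_num by rewrite ge0_fin_numE// ltW.
  rewrite /zeta /zeta_fun -/q -(fineK psifin) -(fineK nufin).
  have s0 : (0 < fine (psi p))%R by rewrite -lte_fin fineK.
  have t0 : (0 < fine (nu q))%R by rewrite -lte_fin fineK.
  move: (fine (psi p)) (fine (nu q)) s0 t0 leK leL => s t s0 t0 leK leL.
  rewrite -EFinM inver gt_eqF ?mulr_gt0// -!EFinM lee_fin.
  have bebe : (be^-1 `^ p^-1 * be `^ p^-1 = 1)%R.
    by rewrite -powRM ?invr_ge0 ?ltW// mulVf ?gt_eqF// powR1.
  have {}cov_le : (c <= 2 * be `^ p^-1 * (K * s) * (L * t))%R.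
    apply: (le_trans cov_le); apply: ler_pM;
      rewrite ?mulr_ge0 ?powR_ge0 ?fine_ge0 ?Lnorm_ge0//.
    by rewrite ler_wpM2l ?mulr_ge0 ?powR_ge0.
  rewrite mulrAC ler_pdivrMr ?mulr_gt0//.
  rewrite (le_trans (ler_wpM2l (powR_ge0 _ _) cov_le))//.
  rewrite le_eqVlt; apply/orP; left; apply/eqP.
  transitivity ((be^-1 `^ p^-1 * be `^ p^-1) * (2 * K * L * (s * t)))%R; first by ring.
  by rewrite bebe mul1r.
(* An admissible exponent exists, as otherwise the fundamental function would be
   zero; it shows that the two norms are finite. *)
have [p [p1 zp]] : exists p : R, (1 < p)%R /\ zeta p < +oo.
  apply: contra_neqP phi_neq0 => /forallNP noex.
  rewrite /phi /fundamental_function.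
  set A := [set p : R | _]; suff -> : A = set0 by rewrite image_set0 ereal_sup0 maxeNy.
  by rewrite -subset0 => p /noex.
have [K [L [KE LE K0 L0 _]]] := bound _ p1 zp.
have phi0 : 0 <= phi by rewrite le_max lexx.
rewrite KE LE -!EFinM.
(* When c > 0, dividing by c bounds the supremum, so phi is finite and the
   quotient by phi is an honest real quotient. *)
have [->|cn0] := eqVneq c 0%R.
  by rewrite mule_ge0 ?inve_ge0// lee_fin !mulr_ge0.
have cpos : (0 < c)%R by rewrite lt_neqAle eq_sym cn0.
have phi_le : phi <= (2 * K * L / c)%:E.
  rewrite ge_max lee_fin divr_ge0 ?mulr_ge0//=.
  apply: ub_ereal_sup => _ [r [r1 zr] <-].
  have [K' [L' [K'E L'E _ _]]] := bound _ r1 zr.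
  move: K'E L'E; rewrite KE LE => -[<-] [<-].
  by rewrite EFinM -lee_pdivlMr ?invr_gt0// inver invr_eq0 gt_eqF// invrK.
have phifin : phi \is a fin_num.
  by rewrite ge0_fin_numE// (le_lt_trans phi_le)// ltry.
move: phi_neq0 phi0 phi_le; rewrite -(fineK phifin).
move: (fine phi) => r; rewrite eqe !lee_fin => r_neq0 r0.
have {r_neq0 r0} r0 : (0 < r)%R by rewrite lt_neqAle eq_sym r_neq0.
rewrite ler_pdivlMr// => rc.
by rewrite inver gt_eqF// -EFinM lee_fin ler_pdivlMr// mulrC.
Qed.
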